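(* Let $A_1,A_2\in M_2(\mathbb R)$ have no eigenvalues in $(-\infty,0]$ and satisfy $\operatorname{PD}(A_1)\subset\operatorname{PD}(A_2)$. Then $\|\log A_1\|_2\le\|\log A_2\|_2$ and $\lfloor\log A_1\rfloor_2\ge\lfloor\log A_2\rfloor_2$.
   Context: For $A=\tilde a\mathrm{Id}_2+\tilde b\tilde I+\tilde c\tilde J+\tilde d\tilde K$ (real coefficients, $\tilde I=\begin{pmatrix}0&-1\\1&0\end{pmatrix}$, $\tilde J=\begin{pmatrix}1&0\\0&-1\end{pmatrix}$, $\tilde K=\begin{pmatrix}0&1\\1&0\end{pmatrix}$), the principal disk is $\operatorname{PD}(A)=\overline D(\tilde a+|\tilde b|i,\sqrt{\tilde c^2+\tilde d^2})\subset\mathbb C$. $\|\cdot\|_2$ is the operator norm; $\lfloor X\rfloor_2=\det X/\|X\|_2$ for $X\ne0$, $\lfloor 0\rfloor_2=0$; $\log$ is the principal logarithm. *)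

(* Defs.v *)
From HB Require Import structures.
From mathcomp Require Import all_boot all_order all_algebra.
From mathcomp Require Import all_classical all_reals all_analysis.
From mathcomp.real_closed Require Import complex.
Set Implicit Arguments. Unset Strict Implicit. Unset Printing Implicit Defensive.
Import Order.TTheory GRing.Theory Num.Theory numFieldNormedType.Exports.
Local Open Scope classical_set_scope.
Local Open Scope ring_scope.
Local Open Scope complex_scope.

Section Defs.
Variable R : realType.

Definition cmx (A : 'M[R]_2) : 'M[R[i]]_2 := map_mx (fun x : R => x%:C) A.

Definition no_nonpos_eig (A : 'M[R]_2) : Prop :=
  forall z : R[i], eigenvalue (cmx A) z -> ~ (complex.Im z = 0 /\ complex.Re z <= 0).

(* coefficients of A = a Id + b I + c J + d K with
   I = [[0,-1],[1,0]], J = [[1,0],[0,-1]], K = [[0,1],[1,0]] *)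
Definition coef_a (A : 'M[R]_2) : R := (A 0 0 + A 1 1) / 2.
Definition coef_b (A : 'M[R]_2) : R := (A 1 0 - A 0 1) / 2.
Definition coef_c (A : 'M[R]_2) : R := (A 0 0 - A 1 1) / 2.
Definition coef_d (A : 'M[R]_2) : R := (A 1 0 + A 0 1) / 2.

Definition PD (A : 'M[R]_2) : set R[i] :=
  [set z | `|z - (coef_a A +i* `|coef_b A|)| <=
           (Num.sqrt (coef_c A ^+ 2 + coef_d A ^+ 2))%:C].

Definition is_expmx (X E : 'M[R]_2) : Prop :=
  forall i j : 'I_2,
    (fun n : nat => (\sum_(k < n) (k`!%:R)^-1 *: X ^+ k) i j) @ \oo --> E i j.

Definition is_principal_log (A L : 'M[R]_2) : Prop :=
  is_expmx L A /\
  forall z : R[i], eigenvalue (cmx L) z -> - pi < complex.Im z < pi.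

Definition vnorm2 (v : 'cV[R]_2) : R := Num.sqrt (v 0 0 ^+ 2 + v 1 0 ^+ 2).
Definition opnorm2 (X : 'M[R]_2) : R :=
  sup [set vnorm2 (X *m v) | v in [set v : 'cV[R]_2 | vnorm2 v <= 1]].

Definition floor2 (X : 'M[R]_2) : R :=
  if X == 0 then 0 else \det X / opnorm2 X.

End Defs.

(* Main.v *)
(* The identity log A = \int_0^1 (A - 1) (1 + tau (A - 1))^-1 dtau shows that log is
   monotone for inclusion of principal disks. Indeed inversion of a matrix of positive
   determinant sends the principal disk with center c and radius r to the one with center
   c / D and radius r / D, D = |c|^2 - r^2, i.e. to its image under z |-> 1 / conj z, so
   it preserves inclusion; and tau times the integrand at tau is 1 - (1 + tau (A - 1))^-1.
   Since norm and co-norm of log A are |c| + r and |c| - r for the disk of log A, both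
   inequalities follow. Instead of integrating, one tests disk inclusion in each unit
   direction (p, q) and applies the mean value theorem on [0, 1]; the primitives are
   explicit, in three cases according to the sign of the discriminant of log A. *)
Require Import Defs.
From HB Require Import structures.
From mathcomp Require Import all_boot all_order all_algebra.
From mathcomp Require Import all_classical all_reals all_analysis.
From mathcomp.real_closed Require Import complex.
From mathcomp Require Import ring lra.
Set Implicit Arguments. Unset Strict Implicit. Unset Printing Implicit Defensive.
Import Order.TTheory GRing.Theory Num.Theory numFieldNormedType.Exports.
Local Open Scope classical_set_scope.
Local Open Scope ring_scope.

(** * Inversion of plane disks, and tests in unit directions *)

(** Dividing [(u, v, r)] by [D] is an inversion for the Lorentz form [u ^+ 2 + v ^+ 2 - r ^+ 2], so
    the form of a difference gets divided by [D1 * D2] and keeps its sign. *)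
Lemma inversion_disk (R : realFieldType) (u1 v1 r1 u2 v2 r2 : R)
  (D1 := u1 ^+ 2 + v1 ^+ 2 - r1 ^+ 2) (D2 := u2 ^+ 2 + v2 ^+ 2 - r2 ^+ 2) :
  0 <= r1 -> r1 <= r2 -> 0 < D1 -> 0 < D2 ->
  (u2 - u1) ^+ 2 + (v2 - v1) ^+ 2 <= (r2 - r1) ^+ 2 ->
  r1 / D1 <= r2 / D2 /\
  (u2 / D2 - u1 / D1) ^+ 2 + (v2 / D2 - v1 / D1) ^+ 2
    <= (r2 / D2 - r1 / D1) ^+ 2.
Proof.
move=> r1_ge0 r12 D1_gt0 D2_gt0 cr; split.
  rewrite ler_pdivrMr // mulrAC ler_pdivlMr // -subr_ge0.
  have [/eqP e0|e_neq0] := boolP (r2 - r1 == 0).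
    have r2E : r2 = r1 by apply/eqP; rewrite -subr_eq0 e0.
    move: cr; rewrite e0 => cr.
    have /eqP : (u2 - u1) ^+ 2 + (v2 - v1) ^+ 2 = 0.
      by apply/eqP; rewrite eq_le addr_ge0 ?sqr_ge0 // andbT; lra.
    rewrite paddr_eq0 ?sqr_ge0 // !sqrf_eq0 !subr_eq0 => /andP[/eqP uE /eqP vE].
    by rewrite /D1 /D2 r2E uE vE subrr.
  have e_gt0 : 0 < r2 - r1 by rewrite lt0r e_neq0 subr_ge0.
  (* After multiplication by [r2 - r1], the difference is a sum of two squares plus a nonnegative
     multiple of the gap in the inclusion hypothesis. *)
  rewrite -(pmulr_rge0 _ e_gt0).
  have sq_ge0 : 0 <= ((r2 - r1) * u1 - r1 * (u2 - u1)) ^+ 2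
                   + ((r2 - r1) * v1 - r1 * (v2 - v1)) ^+ 2.
    by rewrite addr_ge0 ?sqr_ge0.
  have gap_ge0 : 0 <= (r1 * (r2 - r1) + r1 ^+ 2) *
      ((r2 - r1) ^+ 2 - (u2 - u1) ^+ 2 - (v2 - v1) ^+ 2).
    by apply: mulr_ge0; [rewrite addr_ge0 ?sqr_ge0 ?mulr_ge0 ?subr_ge0|lra].
  rewrite [leRHS](_ : _ = (((r2 - r1) * u1 - r1 * (u2 - u1)) ^+ 2
                   + ((r2 - r1) * v1 - r1 * (v2 - v1)) ^+ 2) +
      (r1 * (r2 - r1) + r1 ^+ 2) *
      ((r2 - r1) ^+ 2 - (u2 - u1) ^+ 2 - (v2 - v1) ^+ 2)); last first.
    by rewrite /D1 /D2; ring.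
  exact: addr_ge0.
rewrite -subr_ge0.
rewrite [leRHS](_ : _ =
  ((r2 - r1) ^+ 2 - (u2 - u1) ^+ 2 - (v2 - v1) ^+ 2) / (D1 * D2)); last first.
  rewrite /D1 /D2; field.
  by rewrite -/D1 -/D2 !gt_eqF.
by apply: divr_ge0; [lra|rewrite mulr_ge0 // ltW].
Qed.

(** Cauchy-Schwarz, through the identity of Lagrange. *)
Lemma unit_dot_le (R : realFieldType) (p q x y r : R) :
  p ^+ 2 + q ^+ 2 = 1 -> 0 <= r -> x ^+ 2 + y ^+ 2 <= r ^+ 2 ->
  p * x + q * y <= r.
Proof.
move=> pq r_ge0 xyr; rewrite leNgt; apply/negP => lt_r.
have : r ^+ 2 < (p * x + q * y) ^+ 2.
  by rewrite ltr_sqr ?nnegrE // ltW // (le_lt_trans r_ge0).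
have := sqr_ge0 (p * y - q * x).
have : (p * x + q * y) ^+ 2 + (p * y - q * x) ^+ 2 = x ^+ 2 + y ^+ 2.
  by rewrite -[RHS]mul1r -pq; ring.
lra.
Qed.

Lemma unit_dot_attained (R : rcfType) (x y : R) :
  exists p q : R, p ^+ 2 + q ^+ 2 = 1 /\
    p * x + q * y = Num.sqrt (x ^+ 2 + y ^+ 2).
Proof.
have N_ge0 : 0 <= x ^+ 2 + y ^+ 2 by rewrite addr_ge0 ?sqr_ge0.
have [N0|] := eqVneq (x ^+ 2 + y ^+ 2) 0.
  have /andP[/eqP-> /eqP->] : (x == 0) && (y == 0).
    by rewrite -(sqrf_eq0 x) -(sqrf_eq0 y) -paddr_eq0 ?sqr_ge0 // N0.
  by exists 1, 0; rewrite expr0n /= !addr0 sqrtr0; split; ring.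
move=> N_neq0; set N := Num.sqrt _.
have N_gt0 : 0 < N by rewrite sqrtr_gt0 lt0r N_neq0.
have NE : N ^+ 2 = x ^+ 2 + y ^+ 2 by rewrite sqr_sqrtr.
exists (x / N), (y / N); split.
  by rewrite !expr_div_n -mulrDl NE divff.
by rewrite mulrAC -expr2 [y / N * y]mulrAC -expr2 -mulrDl -NE expr2 mulfK // gt_eqF.
Qed.

Lemma ord2P (i : 'I_2) : i = 0 \/ i = 1.
Proof. by case: i => [[|[|//]]] ?; [left|right]; apply/val_inj. Qed.

(** * Operator norm and co-norm in terms of the principal disk *)

Section OperatorNorm.
Variable R : realType.
Implicit Types (X L A : 'M[R]_2) (v : 'cV[R]_2).

Definition center_norm X : R := Num.sqrt (coef_a X ^+ 2 + coef_b X ^+ 2).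
Definition radius X : R := Num.sqrt (coef_c X ^+ 2 + coef_d X ^+ 2).

Lemma center_norm_ge0 X : 0 <= center_norm X. Proof. exact: sqrtr_ge0. Qed.
Lemma radius_ge0 X : 0 <= radius X. Proof. exact: sqrtr_ge0. Qed.

Lemma center_norm_sqr X : center_norm X ^+ 2 = coef_a X ^+ 2 + coef_b X ^+ 2.
Proof. by rewrite sqr_sqrtr // addr_ge0 ?sqr_ge0. Qed.

Lemma radius_sqr X : radius X ^+ 2 = coef_c X ^+ 2 + coef_d X ^+ 2.
Proof. by rewrite sqr_sqrtr // addr_ge0 ?sqr_ge0. Qed.

Lemma mx2_coef X :
  [/\ X 0 0 = coef_a X + coef_c X, X 0 1 = coef_d X - coef_b X,
      X 1 0 = coef_d X + coef_b X & X 1 1 = coef_a X - coef_c X].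
Proof. by rewrite /coef_a /coef_b /coef_c /coef_d; split; field. Qed.

Lemma det_mx2 X : \det X = center_norm X ^+ 2 - radius X ^+ 2.
Proof.
rewrite center_norm_sqr radius_sqr.
rewrite (expand_det_row _ 0) !big_ord_recl big_ord0 /cofactor !det_mx11 !mxE /=.
have -> : lift 0 0 = 1 :> 'I_2 by apply/val_inj.
have -> : lift 1 0 = 0 :> 'I_2 by apply/val_inj.
have [-> -> -> ->] := mx2_coef X.
by rewrite /= /bump /= expr0 expr1; ring.
Qed.

Lemma vnorm2_mulmx_sqr X v : vnorm2 (X *m v) ^+ 2 =
  (X 0 0 * v 0 0 + X 0 1 * v 1 0) ^+ 2 + (X 1 0 * v 0 0 + X 1 1 * v 1 0) ^+ 2.
Proof.
rewrite /vnorm2 sqr_sqrtr ?addr_ge0 ?sqr_ge0 // !mxE !big_ord_recl !big_ord0.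
have -> : lift 0 0 = 1 :> 'I_2 by apply/val_inj.
by rewrite !addr0.
Qed.

Lemma vnorm2_ge0 v : 0 <= vnorm2 v. Proof. exact: sqrtr_ge0. Qed.

Lemma vnorm2_sqr v : vnorm2 v ^+ 2 = v 0 0 ^+ 2 + v 1 0 ^+ 2.
Proof. by rewrite sqr_sqrtr // addr_ge0 ?sqr_ge0. Qed.

(** On the plane read as the complex line, [X] acts by [v |-> z v + w conj(v)] with [z = a + i b]
    and [w = c + i d]; the bound is the triangle inequality. The proof expands squares and bounds
    the inner product of the two terms. *)
Lemma vnorm2_mulmx_le X v :
  vnorm2 (X *m v) <= (center_norm X + radius X) * vnorm2 v.
Proof.
have N_ge0 := center_norm_ge0 X; have r_ge0 := radius_ge0 X.
rewrite -(@ler_pXn2r _ 2) ?nnegrE ?mulr_ge0 ?addr_ge0 ?vnorm2_ge0 //.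
rewrite exprMn vnorm2_mulmx_sqr vnorm2_sqr.
have NE := center_norm_sqr X; have rE := radius_sqr X.
have [-> -> -> ->] := mx2_coef X.
move: NE rE N_ge0 r_ge0.
move: (center_norm X) (radius X) (coef_a X) (coef_b X) (coef_c X) (coef_d X).
move: (v 0 0) (v 1 0) => s t N r a b c d NE rE N_ge0 r_ge0.
have z_sqr : (a * s - b * t) ^+ 2 + (b * s + a * t) ^+ 2
            = N ^+ 2 * (s ^+ 2 + t ^+ 2) by rewrite NE; ring.
have w_sqr : (c * s + d * t) ^+ 2 + (d * s - c * t) ^+ 2
            = r ^+ 2 * (s ^+ 2 + t ^+ 2) by rewrite rE; ring.
have zw : (a * s - b * t) * (c * s + d * t) + (b * s + a * t) * (d * s - c * t)
          <= N * r * (s ^+ 2 + t ^+ 2).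
  apply: le_trans (ler_norm _) _.
  rewrite -(@ler_pXn2r _ 2) ?nnegrE ?mulr_ge0 ?addr_ge0 ?sqr_ge0 //.
  rewrite real_normK ?num_real //.
  rewrite [leRHS](_ : _ = N ^+ 2 * (s ^+ 2 + t ^+ 2) * (r ^+ 2 * (s ^+ 2 + t ^+ 2))); last by ring.
  rewrite -z_sqr -w_sqr -subr_ge0.
  rewrite [leRHS](_ : _ = ((a * s - b * t) * (d * s - c * t)
     - (b * s + a * t) * (c * s + d * t)) ^+ 2) ?sqr_ge0 //; ring.
rewrite [leLHS](_ : _ = N ^+ 2 * (s ^+ 2 + t ^+ 2) + r ^+ 2 * (s ^+ 2 + t ^+ 2) +
   ((a * s - b * t) * (c * s + d * t) + (b * s + a * t) * (d * s - c * t)) *+ 2); last first.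
  by rewrite -z_sqr -w_sqr; ring.
rewrite [leRHS](_ : _ = N ^+ 2 * (s ^+ 2 + t ^+ 2) + r ^+ 2 * (s ^+ 2 + t ^+ 2) +
   (N * r * (s ^+ 2 + t ^+ 2)) *+ 2); last by ring.
by rewrite lerD2l lerMn2r zw orbT.
Qed.

Lemma vnorm2_mulmx_attained X : exists2 v, 0 < vnorm2 v &
  vnorm2 (X *m v) = (center_norm X + radius X) * vnorm2 v.
Proof.
have N_ge0 := center_norm_ge0 X; have r_ge0 := radius_ge0 X.
pose w s t : 'cV[R]_2 := \col_i (if i == 0 then s else t).
have wE s t : w s t 0 0 = s /\ w s t 1 0 = t by rewrite !mxE.
suff [s [t [st_neq0 stE]]] : exists s t, 0 < s ^+ 2 + t ^+ 2 /\
   (X 0 0 * s + X 0 1 * t) ^+ 2 + (X 1 0 * s + X 1 1 * t) ^+ 2 =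
   (center_norm X + radius X) ^+ 2 * (s ^+ 2 + t ^+ 2).
  have [w0 w1] := wE s t; exists (w s t).
    by rewrite sqrtr_gt0 w0 w1.
  apply/eqP; rewrite -(@eqrXn2 _ 2) ?mulr_ge0 ?addr_ge0 ?vnorm2_ge0 //.
  by rewrite exprMn vnorm2_mulmx_sqr vnorm2_sqr w0 w1 stE.
have NE := center_norm_sqr X; have rE := radius_sqr X.
have [-> -> -> ->] := mx2_coef X.
move: NE rE N_ge0 r_ge0.
move: (center_norm X) (radius X) (coef_a X) (coef_b X) (coef_c X) (coef_d X).
move=> N r a b c d NE rE N_ge0 r_ge0.
have kE : (N * r) ^+ 2 = (a * c + b * d) ^+ 2 + (a * d - b * c) ^+ 2.
  by rewrite exprMn NE rE; ring.
(* The cross term of the form is g (s^2 - t^2) + 2 h s t with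
   g = a c + b d, h = a d - b c and g^2 + h^2 = (N r)^2. *)
have formE s t : ((a + c) * s + (d - b) * t) ^+ 2 + ((d + b) * s + (a - c) * t) ^+ 2
  = (N ^+ 2 + r ^+ 2) * (s ^+ 2 + t ^+ 2)
    + ((a * c + b * d) * (s ^+ 2 - t ^+ 2) + (a * d - b * c) * (s * t) *+ 2) *+ 2.
  by rewrite NE rE; ring.
suff [s [t [st_gt0 stE]]] : exists s t, 0 < s ^+ 2 + t ^+ 2 /\
   (a * c + b * d) * (s ^+ 2 - t ^+ 2) + (a * d - b * c) * (s * t) *+ 2
   = N * r * (s ^+ 2 + t ^+ 2).
  by exists s, t; split=> //; rewrite formE stE; ring.
move: kE; move: (N * r) (a * c + b * d) (a * d - b * c) => k g h kE.
(* The square of the complex number [s + i t] must be a nonnegative multiple of [g + i h]. The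
   half-angle vector [(k + g, h)] does this; it degenerates when [g = - k], where [(0, 1)] works. *)
have [kg0|kg_neq0] := eqVneq (k + g) 0.
  exists 0, 1; split; first by rewrite expr0n /= expr1n add0r ltr01.
  by rewrite expr0n expr1n /= (_ : k = - g); [ring|apply/eqP; rewrite -addr_eq0 kg0].
exists (k + g), h; split.
  by rewrite ltr_wpDr ?sqr_ge0 // lt0r sqr_ge0 sqrf_eq0 kg_neq0.
have hE : h ^+ 2 = (k - g) * (k + g) by rewrite -subr_sqr kE; ring.
rewrite [LHS](_ : _ = g * ((k + g) ^+ 2 - h ^+ 2) + (k + g) * h ^+ 2 *+ 2); last by ring.
by rewrite hE; ring.
Qed.

Lemma opnorm2E X : opnorm2 X = center_norm X + radius X.
Proof.
have N_ge0 := center_norm_ge0 X; have r_ge0 := radius_ge0 X.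
have le_m : ubound [set vnorm2 (X *m v) | v in [set v | vnorm2 v <= 1]]
                   (center_norm X + radius X).
  move=> _ [v /= v_le1 <-]; apply: le_trans (vnorm2_mulmx_le X v) _.
  by rewrite ler_piMr ?addr_ge0.
have [v v_gt0 vE] := vnorm2_mulmx_attained X.
have vnormZ k (w : 'cV[R]_2) : 0 <= k -> vnorm2 (k *: w) = k * vnorm2 w.
  move=> k_ge0; apply/eqP; rewrite -(@eqrXn2 _ 2) ?mulr_ge0 ?vnorm2_ge0 //.
  by rewrite exprMn !vnorm2_sqr !mxE; apply/eqP; ring.
have m_in : [set vnorm2 (X *m v) | v in [set v | vnorm2 v <= 1]]
              (center_norm X + radius X).
  exists ((vnorm2 v)^-1 *: v) => /=.
    by rewrite vnormZ ?invr_ge0 ?vnorm2_ge0 // mulVf // gt_eqF.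
  rewrite -scalemxAr vnormZ ?invr_ge0 ?vnorm2_ge0 // vE.
  by rewrite mulrCA mulVf ?mulr1 // gt_eqF.
apply/eqP; rewrite eq_le; apply/andP; split.
  by apply: ge_sup => //; exists (center_norm X + radius X).
by apply: ub_le_sup => //; exists (center_norm X + radius X).
Qed.

(** The determinant is a difference of squares, and the operator norm cancels the factor
    [center_norm X + radius X]. For [X = 0] the conventional value agrees, both terms being zero. *)
Lemma floor2E X : floor2 X = center_norm X - radius X.
Proof.
have NE := center_norm_sqr X; have rE := radius_sqr X.
rewrite /floor2 opnorm2E det_mx2; case: eqVneq => [->|X_neq0].
  rewrite /center_norm /radius /coef_a /coef_b /coef_c /coef_d !mxE.
  by rewrite !(subr0, addr0, mul0r) expr0n /= addr0 sqrtr0 subr0.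
suff m_neq0 : center_norm X + radius X != 0 by rewrite subr_sqr mulfK.
apply: contra_neq X_neq0 => /eqP.
rewrite paddr_eq0 ?center_norm_ge0 ?radius_ge0 // => /andP[/eqP N0 /eqP r0].
move: NE rE; rewrite N0 r0 expr0n /= => /esym/eqP + /esym/eqP.
rewrite !paddr_eq0 ?sqr_ge0 // !sqrf_eq0 => /andP[/eqP a0 /eqP b0] /andP[/eqP c0 /eqP d0].
have [X00 X01 X10 X11] := mx2_coef X.
apply/matrixP => i j; rewrite mxE.
by have [->|->] := ord2P i; have [->|->] := ord2P j;
  rewrite ?X00 ?X01 ?X10 ?X11 ?a0 ?b0 ?c0 ?d0 ?addr0 ?subr0.
Qed.

End OperatorNorm.

(** * Inclusion of principal disks, and complex eigenvalues *)

Section Disk.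
Variable R : realType.
Implicit Types (X L A : 'M[R]_2).
Local Open Scope complex_scope.

Lemma PDE A (x y : R) : PD A (x +i* y) =
  (Num.sqrt ((x - coef_a A) ^+ 2 + (y - `|coef_b A|) ^+ 2) <= radius A) :> Prop.
Proof. by rewrite /PD /= normc_def lecR. Qed.

(** Inclusion is tested at the point of [PD A1] farthest from the center of [PD A2]: the distance of
    the centers plus [radius A1] is at most [radius A2]. *)
Lemma PD_subset A1 A2 : PD A1 `<=` PD A2 ->
  radius A1 <= radius A2 /\
  (coef_a A2 - coef_a A1) ^+ 2 + (`|coef_b A2| - `|coef_b A1|) ^+ 2
    <= (radius A2 - radius A1) ^+ 2.
Proof.
have r1_ge0 := radius_ge0 A1; have r2_ge0 := radius_ge0 A2.
set d2 := _ + _ => sub.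
have d2_ge0 : 0 <= d2 by rewrite addr_ge0 ?sqr_ge0.
have [p [q [pq pqE]]] := unit_dot_attained (coef_a A1 - coef_a A2) (`|coef_b A1| - `|coef_b A2|).
have {}pqE : p * (coef_a A1 - coef_a A2) + q * (`|coef_b A1| - `|coef_b A2|) = Num.sqrt d2.
  by rewrite pqE; congr Num.sqrt; rewrite /d2; ring.
have : PD A2 ((coef_a A1 + radius A1 * p) +i* (`|coef_b A1| + radius A1 * q)).
  apply: sub; rewrite PDE !(addrC _ (radius A1 * _)) !addrK !exprMn -mulrDr pq mulr1.
  by rewrite sqrtr_sqr ger0_norm.
rewrite PDE => in2.
have le_r : Num.sqrt d2 + radius A1 <= radius A2.
  suff <- : Num.sqrt ((coef_a A1 + radius A1 * p - coef_a A2) ^+ 2 +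
     (`|coef_b A1| + radius A1 * q - `|coef_b A2|) ^+ 2) = Num.sqrt d2 + radius A1 by [].
  rewrite -[RHS]ger0_norm ?addr_ge0 ?sqrtr_ge0 // -(sqrtr_sqr (_ + radius A1)); congr Num.sqrt.
  rewrite [RHS]sqrrD sqr_sqrtr // -pqE -[radius A1 ^+ 2]mulr1 -pq /d2; ring.
have s_ge0 := sqrtr_ge0 d2.
split; first by lra.
by rewrite -{1}(sqr_sqrtr d2_ge0) ler_sqr ?nnegrE; lra.
Qed.

(* M = L - x satisfies M^2 = t Id with t = radius^2 - b^2. *)
Lemma eigenvalue_of_neg_disc L (w : R) : w != 0 ->
  radius L ^+ 2 - coef_b L ^+ 2 = - w ^+ 2 ->
  eigenvalue (cmx L) (coef_a L +i* w).
Proof.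
move=> w_neq0; rewrite radius_sqr => wE.
(* [eigenvalue] refers to row vectors, so [v] is a left eigenvector; its second entry has imaginary
   part [w] and hence is nonzero. *)
pose v : 'rV[R[i]]_2 := \row_j (if j == 0 then (coef_b L + coef_d L)%:C else - coef_c L +i* w).
apply/eigenvalueP; exists v; last first.
  apply/eqP => /matrixP /(_ 0 1); rewrite !mxE /= => /eqP.
  by rewrite eq_complex /= (negPf w_neq0) andbF.
have [L00 L01 L10 L11] := mx2_coef L.
have o01 : lift 0 0 = 1 :> 'I_2 by apply/val_inj.
apply/matrixP => i j; rewrite !mxE !big_ord_recl big_ord0 addr0 !mxE o01 /=.
by have [->|->] := ord2P j; rewrite ?L00 ?L01 ?L10 ?L11 /=;
  apply/eqP; rewrite eq_complex /=; apply/andP; split; apply/eqP; simpc; nra.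
Qed.

End Disk.

(** * The matrix exponential as a pair of scalar power series *)

Section ExponentialSeries.
Variable R : realType.

(* [F + G M] solves [Y' = - (x + M) Y], so its product with [f + g M] is constant. *)
Lemma linear_ode_inverse (x t : R) (f g F G : R -> R) :
  (forall z : R, is_derive z 1 f (x * f z + t * g z)) ->
  (forall z : R, is_derive z 1 g (f z + x * g z)) ->
  (forall z : R, is_derive z 1 F (- (x * F z + t * G z))) ->
  (forall z : R, is_derive z 1 G (- (F z + x * G z))) ->
  f 0 = 1 -> g 0 = 0 -> F 0 = 1 -> G 0 = 0 ->
  forall z, f z * F z + t * (g z * G z) = 1 /\ f z * G z + g z * F z = 0.
Proof.
move=> df dg dF dG f0 g0 F0 G0 z.
(* The two claims are the coefficients of [1] and [M] in [(f + g M) (F + G M) = 1], where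
   [M ^+ 2 = t]. *)
split.
- apply: etrans (_ : f 0 * F 0 + t * (g 0 * G 0) = 1); last first.
    by rewrite f0 g0 F0 G0; ring.
  apply: (@is_derive_0_is_cst R (fun z => f z * F z + t * (g z * G z))) => y.
  by apply: trigger_derive; rewrite /GRing.scale /=; ring.
- apply: etrans (_ : f 0 * G 0 + g 0 * F 0 = 0); last first.
    by rewrite f0 g0 F0 G0; ring.
  apply: (@is_derive_0_is_cst R (fun z => f z * G z + g z * F z)) => y.
  by apply: trigger_derive; rewrite /GRing.scale /=; ring.
Qed.

(** The coefficients of [1] and [M] in [(x + M) ^+ k], where [M ^+ 2 = t]. *)
Fixpoint pow_coefs (x t : R) (k : nat) : R * R :=
  if k is k'.+1 then
    let u := pow_coefs x t k' in (x * u.1 + t * u.2, u.1 + x * u.2)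
  else (1, 0).

(** A geometric bound lets an exponential series dominate the two coefficient series. *)
Lemma pow_coefs_le (x t : R) k (B := 1 + `|x| + `|t|) :
  `|(pow_coefs x t k).1| <= B ^+ k /\ `|(pow_coefs x t k).2| <= B ^+ k.
Proof.
have Bx : `|x| + `|t| <= B by rewrite /B; lra.
have x_ge0 := normr_ge0 x; have t_ge0 := normr_ge0 t.
have B_ge0 : 0 <= B by rewrite /B !addr_ge0.
elim: k => [|k [IH1 IH2]] /=; first by rewrite normr1 normr0 expr0 ler01.
have Bk_ge0 : 0 <= B ^+ k by rewrite exprn_ge0.
split; apply: le_trans (ler_normD _ _) _; rewrite !normrM exprS.
  apply: le_trans (lerD (ler_wpM2l x_ge0 IH1) (ler_wpM2l t_ge0 IH2)) _.
  by rewrite -mulrDl ler_wpM2r.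
apply: le_trans (lerD IH1 (ler_wpM2l x_ge0 IH2)) _.
by rewrite /B; nra.
Qed.

Lemma exprn_pow_coefs (T : algType R) (x t : R) (M : T) k :
  M * M = t%:A ->
  (x%:A + M) ^+ k = (pow_coefs x t k).1%:A + (pow_coefs x t k).2 *: M.
Proof.
move=> M2; elim: k => [|k IH]; first by rewrite /= expr0 scale0r addr0 scale1r.
rewrite exprS IH /=; set p := _.1; set q := _.2.
rewrite mulrDl !mulrDr -!scalerAl -!scalerAr !mul1r !mulr1 M2.
rewrite !scalerA !scalerDl [q * t]mulrC -!addrA; congr (_ + _).
by rewrite addrA [LHS]addrC; congr (_ + _); exact: addrC.
Qed.

Lemma cvg_pseries_dominated (c : R^nat) (B K : R) :
  (forall k, `|c k| <= B ^+ k) -> cvgn (pseries (fun k => k`!%:R^-1 * c k) K).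
Proof.
move=> cB; apply: normed_cvg.
apply: series_le_cvg (is_cvg_series_exp_coeff (B * `|K|)) => //= n.
  (* The sign of [B] is not given; [B ^+ n] is nonnegative because it bounds a norm. *)
  have := cB n; have := normr_ge0 (c n) => c0 /(le_trans c0) B0.
  by rewrite /exp_coeff /= exprMn divr_ge0 // mulr_ge0 // exprn_ge0.
rewrite /exp_coeff /= !normrM normfV normr_nat normrX exprMn.
by rewrite [leRHS]mulrC mulrA ler_wpM2r ?exprn_ge0 // ler_wpM2l ?invr_ge0.
Qed.

Lemma pseries_lim_comb (c d : R^nat) (u v K : R) :
  cvgn (pseries c K) -> cvgn (pseries d K) ->
  pseries (fun k => u * c k + v * d k) K @ \oo -->
    u * limn (pseries c K) + v * limn (pseries d K).
Proof.
move=> cc cd.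
rewrite (_ : pseries _ _ = fun n => u * pseries c K n + v * pseries d K n).
  by apply: cvgD; apply: cvgMl_tmp.
apply/funext => n; rewrite /pseries /series /= !mulr_sumr -big_split /=.
by apply: eq_bigr => k _; ring.
Qed.

Lemma pseries_diffs_fact (c : R^nat) :
  pseries_diffs (fun k => k`!%:R^-1 * c k) = (fun k => k`!%:R^-1 * c k.+1).
Proof.
by apply/funext => k; rewrite /pseries_diffs factS natrM invfM mulrA mulVKf.
Qed.

(** Here [f z + g z M] is the exponential of [z (x + M)]. The variable [z] turns the two series into
    a linear differential system, from which closed forms are found later. *)
Lemma exp_pow_coefs (x t : R) : exists f g : R -> R,
  [/\ f 0 = 1, g 0 = 0,
     forall z : R, is_derive z 1 f (x * f z + t * g z),
     forall z : R, is_derive z 1 g (f z + x * g z) &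
     (series (fun k => k`!%:R^-1 * (pow_coefs x t k).1) @ \oo --> f 1) /\
     (series (fun k => k`!%:R^-1 * (pow_coefs x t k).2) @ \oo --> g 1)].
Proof.
pose p k := k`!%:R^-1 * (pow_coefs x t k).1.
pose q k := k`!%:R^-1 * (pow_coefs x t k).2.
have pcv K : cvgn (pseries p K).
  by apply: cvg_pseries_dominated => k; exact: (pow_coefs_le x t k).1.
have qcv K : cvgn (pseries q K).
  by apply: cvg_pseries_dominated => k; exact: (pow_coefs_le x t k).2.
have dp : pseries_diffs p = fun k => x * p k + t * q k.
  by rewrite pseries_diffs_fact; apply/funext => k /=; rewrite /p /q; ring.
have dq : pseries_diffs q = fun k => 1 * p k + x * q k.
  by rewrite pseries_diffs_fact; apply/funext => k /=; rewrite /p /q; ring.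
(* Termwise differentiation at [z] asks that the series and its first two formal derivatives
   converge at a point of larger modulus, below [|z| + 1]. *)
have ddcomb u v : pseries_diffs (fun k => u * p k + v * q k) =
    fun k => (u * x + v) * p k + (u * t + v * x) * q k.
  apply/funext => k; have := congr1 (@^~ k) dp; have := congr1 (@^~ k) dq.
  rewrite /pseries_diffs /= => eq ep.
  transitivity (u * (k.+1%:R * p k.+1) + v * (k.+1%:R * q k.+1)); first by ring.
  by rewrite eq ep; ring.
have combcv u v K : cvgn (pseries (fun k => u * p k + v * q k) K).
  by apply/cvg_ex; exists (u * limn (pseries p K) + v * limn (pseries q K));
    exact: pseries_lim_comb.
have at0 (c : R^nat) : limn (pseries c 0) = c 0%N.
  apply/cvg_lim => //; rewrite -cvg_shiftS /=.
  rewrite (_ : (fun _ => _) = fun=> c 0%N); first exact: cvg_cst.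
  apply/funext => n; rewrite /pseries /series /= big_nat_recl // expr0 mulr1.
  by rewrite big1 ?addr0 // => i _; rewrite expr0n mulr0.
have at1 (c : R^nat) : pseries c 1 = series c.
  by apply/funext => n; apply: eq_bigr => k _; rewrite /= expr1n mulr1.
exists (fun z => limn (pseries p z)), (fun z => limn (pseries q z)); split.
- by rewrite at0 /p /= fact0 invr1 mulr1.
- by rewrite at0 /q /= mulr0.
- move=> z; rewrite -(cvg_lim _ (pseries_lim_comb (u := x) (v := t) (pcv z) (qcv z))) // -dp.
  apply: (@pseries_snd_diffs _ _ (`|z| + 1)) => //; rewrite ?dp ?ddcomb //.
  by rewrite [ltRHS]ger0_norm // ?ltrDl // addr_ge0.
- move=> z; rewrite -[limn (pseries p z)]mul1r.
  rewrite -(cvg_lim _ (pseries_lim_comb (u := 1) (v := x) (pcv z) (qcv z))) // -dq.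
  apply: (@pseries_snd_diffs _ _ (`|z| + 1)) => //; rewrite ?dq ?ddcomb //.
  by rewrite [ltRHS]ger0_norm // ?ltrDl // addr_ge0.
by rewrite -!at1; split; [exact: pcv|exact: qcv].
Qed.

(* [2 x 2] Cayley-Hamilton turns [exp L] into [f + g (L - x)]. *)
Lemma is_expmx_coefs (L A : 'M[R]_2) (x := coef_a L)
    (t := radius L ^+ 2 - coef_b L ^+ 2) (f g : R) :
  is_expmx L A ->
  series (fun k => k`!%:R^-1 * (pow_coefs x t k).1) @ \oo --> f ->
  series (fun k => k`!%:R^-1 * (pow_coefs x t k).2) @ \oo --> g ->
  [/\ coef_a A = f, coef_b A = g * coef_b L, coef_c A = g * coef_c L
    & coef_d A = g * coef_d L].
Proof.
move=> expLA fcv gcv; pose M : 'M[R]_2 := L - x *: 1.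
have [L00 L01 L10 L11] := mx2_coef L.
have o01 : lift 0 0 = 1 :> 'I_2 by apply/val_inj.
have M2 : M * M = t *: 1.
  apply/matrixP => i j.
  rewrite !mxE !big_ord_recl big_ord0 addr0 !mxE o01 /t radius_sqr.
  by have [->|->] := ord2P i; have [->|->] := ord2P j;
    rewrite ?L00 ?L01 ?L10 ?L11 /= /x; ring.
have AE i j : A i j = f * (i == j)%:R + g * M i j.
  rewrite -(cvg_lim _ (expLA i j)) //; apply/cvg_lim => //.
  rewrite (_ : (fun _ => _) = fun n =>
     series (fun k => k`!%:R^-1 * (pow_coefs x t k).1) n * (i == j)%:R +
     series (fun k => k`!%:R^-1 * (pow_coefs x t k).2) n * M i j).
    by apply: cvgD; apply: cvgMr_tmp.
  apply/funext => n; rewrite summxE /series /= !big_mkord !mulr_suml -big_split /=.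
  apply: eq_bigr => k _.
  have -> : L = x%:A + M by rewrite addrC subrK.
  by rewrite (exprn_pow_coefs _ _ M2) !mxE; ring.
rewrite /coef_a /coef_b /coef_c /coef_d !AE !mxE /= L00 L01 L10 L11.
by split; rewrite /x; field.
Qed.

End ExponentialSeries.

(** * Explicit logarithm along the segment from the identity to [A] *)

Section Segment.
Variable R : realType.

(* On the segment from [1] to [A = a + s M], [M^2 = t], [D tau] is the
   determinant; [T tau] is the [M]-coefficient of the logarithm, up to the factor [s]. *)
Definition seg_det (a s t tau : R) : R :=
  (1 + tau * (a - 1)) ^+ 2 - tau ^+ 2 * s ^+ 2 * t.

(** The equation in [expR x] says that the determinant of an exponential is the exponential of the
    trace. The derivative of [T] is the [M]-coefficient of [(A - 1) (1 + tau (A - 1))^-1] divided by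
    [s], and [s * T 1 = 1] since the logarithm ends at [x + M]. *)
Definition log_segment (x t a s : R) (T : R -> R) : Prop :=
  [/\ 0 < s, a ^+ 2 - s ^+ 2 * t = expR x ^+ 2,
      forall tau : R, 0 <= tau <= 1 ->
        0 < seg_det a s t tau /\ is_derive tau 1 T (seg_det a s t tau)^-1,
      T 0 = 0 & s * T 1 = 1].

Lemma lerp_gt0 (P tau : R) : 0 < P -> 0 <= tau <= 1 -> 0 < 1 + tau * (P - 1).
Proof.
move=> P_gt0 /andP[tau_ge0 tau_le1]; have [->|tau_neq0] := eqVneq tau 0.
  by rewrite mul0r addr0.
have : 0 < tau * P by rewrite mulr_gt0 // lt0r tau_neq0.
by lra.
Qed.

Variables (x t : R) (f g : R -> R).
Hypotheses (df : forall z : R, is_derive z 1 f (x * f z + t * g z))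
  (dg : forall z : R, is_derive z 1 g (f z + x * g z))
  (f0 : f 0 = 1) (g0 : g 0 = 0).

(** Here [M] squares to zero, so [exp (- z (x + M)) = exp (- x z) (1 - z M)], and [seg_det] is the
    square of an affine function. *)
Lemma log_segment_zero : t = 0 -> exists T, log_segment x t (f 1) (g 1) T.
Proof.
move=> t0; have m_gt0 := expR_gt0 x; have m_neq0 := lt0r_neq0 m_gt0.
have [||||e1 e2] := @linear_ode_inverse R x t f g (fun z => expR (- (x * z)))
  (fun z => - (z * expR (- (x * z)))) df dg _ _ f0 g0 _ _ 1.
- by move=> z; apply: trigger_derive; rewrite /GRing.scale /= t0; ring.
- by move=> z; apply: trigger_derive; rewrite /GRing.scale /=; ring.
- by rewrite mulr0 oppr0 expR0.
- by rewrite mul0r oppr0.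
move: e1 e2; rewrite t0 mul0r addr0 mul1r mulr1 expRN => e1 e2.
have fE : f 1 = expR x by apply: (mulIf (invr_neq0 m_neq0)); rewrite mulfV.
have gE : g 1 = expR x.
  apply: (mulIf (invr_neq0 m_neq0)); rewrite mulfV //.
  by move: e2; rewrite fE mulrN mulfV // => /eqP; rewrite addrC subr_eq0 => /eqP.
rewrite fE gE; exists (fun tau => tau / (1 + tau * (expR x - 1))); split => //=.
- by rewrite mulr0 subr0.
- move=> tau tau01; have u_gt0 := lerp_gt0 m_gt0 tau01.
  have u_neq0 := lt0r_neq0 u_gt0.
  rewrite /seg_det mulr0 subr0; split; first by rewrite exprn_gt0.
  have du := @is_deriveV R (fun tau => 1 + tau * (expR x - 1)) tau 1 _ u_neq0 _.
  by apply: trigger_derive; rewrite /GRing.scale /=; field.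
- by rewrite mul0r.
- by rewrite mul1r mul1r addrC subrK mulfV.
Qed.

(** With [M] acting as [k] or [- k], the eigenvalues of [A] are the exponentials of [x + k] and
    [x - k]. They split [seg_det] into two affine factors, and [T] comes from partial fractions. *)
Lemma log_segment_pos (k : R) : 0 < k -> t = k ^+ 2 ->
  exists T, log_segment x t (f 1) (g 1) T.
Proof.
move=> k_gt0 tE; have k_neq0 := lt0r_neq0 k_gt0.
have [||||e1 e2] := @linear_ode_inverse R x t f g
  (fun z => (expR (- ((x + k) * z)) + expR (- ((x - k) * z))) / 2)
  (fun z => (expR (- ((x + k) * z)) - expR (- ((x - k) * z))) / (2 * k)) df dg _ _ f0 g0 _ _ 1.
- by move=> z; apply: trigger_derive; rewrite /GRing.scale /= tE; field.
- by move=> z; apply: trigger_derive; rewrite /GRing.scale /=; field.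
- by rewrite !mulr0 oppr0 expR0; field.
- by rewrite !mulr0 subrr mul0r.
move: e1 e2; rewrite !mulr1 !expRN.
have P_gt0 := expR_gt0 (x + k); have Q_gt0 := expR_gt0 (x - k).
have QP : expR (x - k) < expR (x + k) by rewrite ltr_expR; lra.
have PQ : expR (x + k) * expR (x - k) = expR x ^+ 2.
  by rewrite -expRD expr2 -expRD; congr expR; ring.
have lnP : ln (expR (x + k)) = x + k by rewrite expRK.
have lnQ : ln (expR (x - k)) = x - k by rewrite expRK.
move: P_gt0 Q_gt0 QP PQ lnP lnQ; move: (expR (x + k)) (expR (x - k)).
move=> P Q P_gt0 Q_gt0 QP PQ lnP lnQ; move: (f 1) (g 1) => a s e1 e2.
have P_neq0 := lt0r_neq0 P_gt0; have Q_neq0 := lt0r_neq0 Q_gt0.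
(* Adding [k] or [- k] times [e2] to [e1] gives [(a + k s) / P = 1] and [(a - k s) / Q = 1]. *)
have fgP : a + k * s = P.
  rewrite -[RHS]mul1r -e1 -[LHS]addr0 -(mul0r (- (k * P))) -e2 tE; field.
  by rewrite k_neq0 P_neq0 Q_neq0.
have fgQ : a - k * s = Q.
  rewrite -[RHS]mul1r -e1 -[LHS]addr0 -(mul0r (k * Q)) -e2 tE; field.
  by rewrite k_neq0 P_neq0 Q_neq0.
have fE : a = (P + Q) / 2 by rewrite -fgP -fgQ; field.
have gE : s = (P - Q) / (2 * k) by rewrite -fgP -fgQ; field.
have PQ_neq0 : P - Q != 0 by rewrite subr_eq0 gt_eqF.
rewrite fE gE.
exists (fun tau => (ln (1 + tau * (P - 1)) - ln (1 + tau * (Q - 1))) / (P - Q)); split => //=.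
- by rewrite divr_gt0 ?subr_gt0 // mulr_gt0.
- by rewrite -PQ tE; field.
- move=> tau tau01; have u_gt0 := lerp_gt0 P_gt0 tau01; have v_gt0 := lerp_gt0 Q_gt0 tau01.
  have u_neq0 := lt0r_neq0 u_gt0; have v_neq0 := lt0r_neq0 v_gt0.
  have DE : seg_det ((P + Q) / 2) ((P - Q) / (2 * k)) t tau =
      (1 + tau * (P - 1)) * (1 + tau * (Q - 1)).
    by rewrite /seg_det tE; field.
  rewrite DE; split; first by rewrite mulr_gt0.
  have du := is_derive1_ln u_gt0; have dv := is_derive1_ln v_gt0.
  apply: trigger_derive; rewrite /GRing.scale /=; field.
  by rewrite PQ_neq0 u_neq0 v_neq0.
- by rewrite !mul0r !addr0 ln1 subrr mul0r.
- rewrite !mul1r ![1 + (_ - 1)]addrC !subrK lnP lnQ; field.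
  by rewrite PQ_neq0.
Qed.

Lemma log_segment_neg (w : R) : 0 < w < pi -> t = - w ^+ 2 ->
  exists T, log_segment x t (f 1) (g 1) T.
Proof.
move=> /andP[w_gt0 w_ltpi] tE; have w_neq0 := lt0r_neq0 w_gt0.
have [||||e1 e2] := @linear_ode_inverse R x t f g
  (fun z => expR (- (x * z)) * cos (w * z))
  (fun z => - (expR (- (x * z)) * sin (w * z)) / w) df dg _ _ f0 g0 _ _ 1.
- by move=> z; apply: trigger_derive; rewrite /GRing.scale /= tE; field.
- by move=> z; apply: trigger_derive; rewrite /GRing.scale /=; field.
- by rewrite !mulr0 oppr0 expR0 cos0 mulr1.
- by rewrite !mulr0 oppr0 expR0 sin0 mulr0 oppr0 mul0r.
move: e1 e2; rewrite !mulr1 !expRN; move: (f 1) (g 1) => a s.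
have [m mE] : exists m, m = expR x by exists (expR x).
have m_gt0 : 0 < m by rewrite mE expR_gt0.
rewrite -mE.
have m_neq0 := lt0r_neq0 m_gt0.
(* Since [w < pi], the half angle has positive cosine and is recovered from its tangent by
   [atan]. *)
have w2 : 0 < w / 2 < pi / 2 by lra.
have C_gt0 : 0 < cos (w / 2) by apply: cos_gt0_pihalf; lra.
have S_gt0 : 0 < sin (w / 2) by apply: sin_gt0_pi; lra.
have wE : w = (w / 2) *+ 2 by field.
have S2 := sin2cos2 (w / 2).
have cE : cos w = 2 * cos (w / 2) ^+ 2 - 1 by rewrite {1}wE cos_mulr2n; ring.
have sE : sin w = 2 * cos (w / 2) * sin (w / 2) by rewrite {1}wE sin_mulr2n; ring.
have tanE : atan (sin (w / 2) / cos (w / 2)) = w / 2.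
  by apply: tanK; rewrite in_itv /=; lra.
rewrite cE sE.
move: (cos (w / 2)) (sin (w / 2)) C_gt0 S_gt0 S2 tanE => C S C_gt0 S_gt0 S2 tanE.
have C_neq0 := lt0r_neq0 C_gt0; have S_neq0 := lt0r_neq0 S_gt0.
move=> e1 e2.
(* Both [a] and [s] are read off after multiplying [(a + s M) (F + G M) = 1] by
   [m (cos w + (sin w / w) M)], the inverse of [F + G M]. *)
have aE : a = m * (2 * C ^+ 2 - 1).
  transitivity (m * (2 * C ^+ 2 - 1) * (a * (m^-1 * (2 * C ^+ 2 - 1)) +
      t * (s * (- (m^-1 * (2 * C * S)) / w))) - w * (2 * C * S) * m *
      (a * (- (m^-1 * (2 * C * S)) / w) + s * (m^-1 * (2 * C ^+ 2 - 1)))).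
    rewrite tE.
    transitivity (a * (4 * C ^+ 2 * (S ^+ 2) + (2 * C ^+ 2 - 1) ^+ 2)); first by rewrite S2; ring.
    by field; rewrite m_neq0 w_neq0.
  by rewrite e1 e2; ring.
have sE' : s = m * (2 * C * S) / w.
  transitivity (m * (2 * C * S) / w * (a * (m^-1 * (2 * C ^+ 2 - 1)) +
      t * (s * (- (m^-1 * (2 * C * S)) / w))) + (2 * C ^+ 2 - 1) * m *
      (a * (- (m^-1 * (2 * C * S)) / w) + s * (m^-1 * (2 * C ^+ 2 - 1)))).
    rewrite tE.
    transitivity (s * (4 * C ^+ 2 * (S ^+ 2) + (2 * C ^+ 2 - 1) ^+ 2)); first by rewrite S2; ring.
    by field; rewrite m_neq0 w_neq0.
  by rewrite e1 e2; ring.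
have swE : s ^+ 2 * t = - (m ^+ 2 * (4 * C ^+ 2 * S ^+ 2)) by rewrite sE' tE; field.
pose N tau : R := tau * (m + 1) - 1; pose P tau : R := 1 + tau * (m - 1).
(* Rotating [1 + tau (m e^(i w) - 1)] by [e^(- i w / 2)] moves it to the right half-plane. *)
have DE tau : seg_det a s t tau = C ^+ 2 * P tau ^+ 2 + S ^+ 2 * N tau ^+ 2.
  by rewrite /seg_det -mulrA swE S2 aE /P /N; ring.
(* The numerator is the argument of [1 + tau (m e^(i w) - 1)], whose rotated value is
   [C * P tau + i S * N tau]; the denominator is [m sin w = s w]. At [tau = 0] the two angles
   cancel, at [tau = 1] they add up to [w]. *)
exists (fun tau => (w / 2 + atan (S / C * (N tau / P tau))) / (m * (2 * C * S))); split.
- by rewrite sE' divr_gt0 // !mulr_gt0.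
- by rewrite swE S2 aE -mE; ring.
- move=> tau tau01; have P_gt0 := lerp_gt0 m_gt0 tau01.
  have P_neq0 := lt0r_neq0 P_gt0.
  have D_gt0 : 0 < C ^+ 2 * P tau ^+ 2 + S ^+ 2 * N tau ^+ 2.
    apply: ltr_wpDr; first by apply: mulr_ge0; exact: sqr_ge0.
    by rewrite mulr_gt0 ?exprn_gt0.
  have D_neq0 := lt0r_neq0 D_gt0.
  rewrite DE; split=> //.
  have dV := @is_deriveV R P tau 1 _ P_neq0 _.
  have dat := is_derive1_atan (S / C * (N tau / P tau)).
  apply: trigger_derive; rewrite /GRing.scale /=.
  rewrite /P /N in P_neq0 D_neq0 *; field.
  by rewrite !exprMn D_neq0 P_neq0 C_neq0 S_neq0.
- rewrite /= /N /P !mul0r sub0r addr0 divr1 mulrN1 atanN tanE subrr mul0r //.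
- rewrite /= /N /P !mul1r addrK [1 + (_ - 1)]addrC subrK divff // mulr1 tanE sE'; field.
  by rewrite w_neq0 m_neq0 C_neq0 S_neq0.
Qed.

End Segment.

(** [A = a + s (L - x)] with [s > 0], so the [b] coefficient and the radius scale by [s]. When
    [t < 0], the spectral condition on the logarithm gives [Num.sqrt (- t) < pi]. *)
Lemma principal_log_segment (R : realType) (A L : 'M[R]_2) :
  is_principal_log A L -> exists s T,
    [/\ log_segment (coef_a L) (radius L ^+ 2 - coef_b L ^+ 2) (coef_a A) s T,
       coef_b A = s * coef_b L & radius A = s * radius L].
Proof.
move=> [expLA imL]; set t := _ - _.
have [f [g [f0 g0 df dg [fcv gcv]]]] := exp_pow_coefs (coef_a L) t.
have [aE bE cE dE] := is_expmx_coefs expLA fcv gcv.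
suff [T TP] : exists T, log_segment (coef_a L) t (f 1) (g 1) T.
  exists (g 1), T; rewrite aE; split=> //.
  have [g1_gt0 _ _ _ _] := TP.
  rewrite /radius cE dE !exprMn -mulrDr sqrtrM ?sqr_ge0 // sqrtr_sqr.
  by rewrite gtr0_norm.
have [t_lt0|t_gt0|t0] := ltgtP t 0; last exact: log_segment_zero df dg f0 g0 t0.
  have w_gt0 : 0 < Num.sqrt (- t) by rewrite sqrtr_gt0 oppr_gt0.
  have tE : t = - Num.sqrt (- t) ^+ 2 by rewrite sqr_sqrtr ?opprK // oppr_ge0 ltW.
  apply: (log_segment_neg df dg f0 g0 _ tE); rewrite w_gt0 /=.
  by have /andP[] := imL _ (eigenvalue_of_neg_disc (lt0r_neq0 w_gt0) tE).
have k_gt0 : 0 < Num.sqrt t by rewrite sqrtr_gt0.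
by apply: (log_segment_pos df dg f0 g0 k_gt0); rewrite sqr_sqrtr // ltW.
Qed.

(** * Monotonicity of the logarithm for disk inclusion *)

Lemma ge0_derive_le01 (R : realType) (h dh : R -> R) :
  (forall tau : R, 0 <= tau <= 1 -> is_derive tau 1 h (dh tau)) ->
  (forall tau : R, 0 < tau < 1 -> 0 <= dh tau) -> h 0 <= h 1.
Proof.
move=> hd dh_ge0.
have [||c] := @MVT R h dh 0 1 ltr01.
- by move=> tau; rewrite in_itv /= => /andP[t0 t1]; apply: hd; rewrite !ltW.
- apply: continuous_in_subspaceT => tau; rewrite inE /= in_itv /= => tau01.
  exact/differentiable_continuous/derivable1_diffP/(@ex_derive _ _ _ _ _ _ _ (hd _ tau01)).
rewrite in_itv /= => c01; rewrite subr0 mulr1 => hE.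
by rewrite -subr_ge0 hE dh_ge0.
Qed.

(** Half the logarithm of the determinant is half the trace of the logarithm, that is, its scalar
    part; the derivative is the scalar part of [(A - 1) (1 + tau (A - 1))^-1]. *)
Lemma log_segment_half_ln (R : realType) (x t a s tau : R) (T : R -> R) :
  log_segment x t a s T -> 0 <= tau <= 1 ->
  is_derive tau 1 (fun u => ln (seg_det a s t u) / 2)
    (((1 + tau * (a - 1)) * (a - 1) - tau * (s ^+ 2 * t)) / seg_det a s t tau).
Proof.
move=> [_ _ /(_ tau) H _ _] /H [D_gt0 _].
have dln := is_derive1_ln D_gt0; have D_neq0 := lt0r_neq0 D_gt0.
have dD : is_derive tau 1 (seg_det a s t)
   (2 * ((1 + tau * (a - 1)) * (a - 1) - tau * (s ^+ 2 * t))).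
  rewrite /seg_det; apply: trigger_derive; rewrite /GRing.scale /=; ring.
have dlnD := is_derive1_comp dln dD.
by apply: trigger_derive; rewrite /GRing.scale /=; field.
Qed.

(* On [A tau = 1 + tau (A - 1)], [tau A' / A] is [1 - 1 / A], whose disk grows with
   that of [A]. *)
Lemma log_segment_mono (R : realType) (x1 b1 r1 a1 s1 x2 b2 r2 a2 s2 p q : R)
    (T1 T2 : R -> R) :
  log_segment x1 (r1 ^+ 2 - b1 ^+ 2) a1 s1 T1 ->
  log_segment x2 (r2 ^+ 2 - b2 ^+ 2) a2 s2 T2 ->
  0 <= s1 * r1 -> s1 * r1 <= s2 * r2 ->
  (a2 - a1) ^+ 2 + (s2 * b2 - s1 * b1) ^+ 2 <= (s2 * r2 - s1 * r1) ^+ 2 ->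
  p ^+ 2 + q ^+ 2 = 1 ->
  p * (x2 - x1) + q * (b2 - b1) <= r2 - r1.
Proof.
move=> seg1 seg2 r1_ge0 r12 disk pq.
have [_ e1 H1 T10 T11] := seg1; have [_ e2 H2 T20 T21] := seg2.
pose D1 := seg_det a1 s1 (r1 ^+ 2 - b1 ^+ 2).
pose D2 := seg_det a2 s2 (r2 ^+ 2 - b2 ^+ 2).
pose E1 (tau : R) := (1 + tau * (a1 - 1)) * (a1 - 1) - tau * (s1 ^+ 2 * (r1 ^+ 2 - b1 ^+ 2)).
pose E2 (tau : R) := (1 + tau * (a2 - 1)) * (a2 - 1) - tau * (s2 ^+ 2 * (r2 ^+ 2 - b2 ^+ 2)).
(* [h tau] is the slack of the claimed inequality for the logarithms at parameter [tau]: zero at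
   [0], and the desired slack at [1]. *)
pose h tau := (s2 * r2 - q * (s2 * b2)) * T2 tau - (s1 * r1 - q * (s1 * b1)) * T1 tau
  - p * (ln (D2 tau) / 2 - ln (D1 tau) / 2).
pose dh tau := (s2 * r2 - q * (s2 * b2)) * (D2 tau)^-1
  - (s1 * r1 - q * (s1 * b1)) * (D1 tau)^-1 - p * (E2 tau / D2 tau - E1 tau / D1 tau).
have hd (tau : R) : 0 <= tau <= 1 -> is_derive tau 1 h (dh tau).
  move=> tau01; have [_ d1] := H1 _ tau01; have [_ d2] := H2 _ tau01.
  have l1 := log_segment_half_ln seg1 tau01; have l2 := log_segment_half_ln seg2 tau01.
  have k1 := @is_deriveZ _ _ _ T1 (s1 * r1 - q * (s1 * b1)) tau 1 _ d1.
  have k2 := @is_deriveZ _ _ _ T2 (s2 * r2 - q * (s2 * b2)) tau 1 _ d2.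
  have l := @is_deriveZ _ _ _ _ p tau 1 _ (@is_deriveB _ _ _ _ _ tau 1 _ _ l2 l1).
  exact: (@is_deriveB _ _ _ _ _ tau 1 _ _ (@is_deriveB _ _ _ _ _ tau 1 _ _ k2 k1) l).
have dh_ge0 (tau : R) : 0 < tau < 1 -> 0 <= dh tau.
  move=> /andP[tau_gt0 tau_lt1].
  have tau01 : 0 <= tau <= 1 by rewrite !ltW.
  have [D1_gt0 _] := H1 _ tau01; have [D2_gt0 _] := H2 _ tau01.
  pose u1 := 1 + tau * (a1 - 1); pose u2 := 1 + tau * (a2 - 1).
  have D1E : u1 ^+ 2 + (tau * (s1 * b1)) ^+ 2 - (tau * (s1 * r1)) ^+ 2 = D1 tau.
    by rewrite /D1 /seg_det /u1; ring.
  have D2E : u2 ^+ 2 + (tau * (s2 * b2)) ^+ 2 - (tau * (s2 * r2)) ^+ 2 = D2 tau.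
    by rewrite /D2 /seg_det /u2; ring.
  have := @inversion_disk R u1 (tau * (s1 * b1)) (tau * (s1 * r1))
                            u2 (tau * (s2 * b2)) (tau * (s2 * r2)).
  rewrite D1E D2E => /(_ _ _ D1_gt0 D2_gt0) [].
  - by rewrite mulr_ge0 // ltW.
  - by rewrite ler_pM2l.
  - rewrite [leLHS](_ : _ = tau ^+ 2 * ((a2 - a1) ^+ 2 + (s2 * b2 - s1 * b1) ^+ 2)).
      rewrite [leRHS](_ : _ = tau ^+ 2 * (s2 * r2 - s1 * r1) ^+ 2); last by ring.
      by rewrite ler_pM2l ?exprn_gt0.
    by rewrite /u1 /u2; ring.
  (* In [1 - 1 / A] the scalar part of the inverse changes sign, while the sign of its [b] part is
     already absorbed by the conjugation; hence the direction [(- p, q)]. *)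
  rewrite -subr_ge0 => e_ge0 /(@unit_dot_le R (- p) q _ _ _ _ e_ge0).
  rewrite sqrrN => /(_ pq); rewrite -subr_ge0 -(pmulr_rge0 (dh tau) tau_gt0).
  move=> /le_trans; apply; rewrite le_eqVlt; apply/orP; left; apply/eqP; rewrite /dh.
  have E1E : tau * E1 tau = D1 tau - u1 by rewrite -D1E /E1 /u1; ring.
  have E2E : tau * E2 tau = D2 tau - u2 by rewrite -D2E /E2 /u2; ring.
  rewrite [RHS](_ : _ = (s2 * r2 - q * (s2 * b2)) * tau / D2 tau
    - (s1 * r1 - q * (s1 * b1)) * tau / D1 tau
    - p * (tau * E2 tau / D2 tau - tau * E1 tau / D1 tau)); last by ring.
  rewrite E1E E2E; field.
  by rewrite !lt0r_neq0.
have := ge0_derive_le01 hd dh_ge0.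
have seg0 a s t : seg_det a s t 0 = 1 :> R by rewrite /seg_det; ring.
have seg1E a s t : seg_det a s t 1 = a ^+ 2 - s ^+ 2 * t :> R by rewrite /seg_det; ring.
have lnE (x : R) : ln (expR x ^+ 2) / 2 = x.
  by rewrite expr2 -expRD expRK; field.
rewrite /h /D1 /D2 !seg0 !seg1E e1 e2 !lnE T10 T20 ln1.
rewrite [leLHS](_ : _ = 0); last by ring.
rewrite [leRHS](_ : _ = (r2 - q * b2) * (s2 * T2 1) - (r1 - q * b1) * (s1 * T1 1)
   - p * (x2 - x1)); last by ring.
by rewrite T11 T21; lra.
Qed.

(* Disk inclusion is tested in each direction [(p, q)]. *)
Lemma log_direction_le (R : realType) (A1 A2 L1 L2 : 'M[R]_2) (p q : R) :
  is_principal_log A1 L1 -> is_principal_log A2 L2 -> PD A1 `<=` PD A2 ->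
  p ^+ 2 + q ^+ 2 = 1 ->
  p * (coef_a L2 - coef_a L1) + q * (`|coef_b L2| - `|coef_b L1|)
    <= radius L2 - radius L1.
Proof.
move=> /principal_log_segment[s1 [T1 [seg1 b1E r1E]]].
move=> /principal_log_segment[s2 [T2 [seg2 b2E r2E]]].
move=> /PD_subset; have := radius_ge0 A1.
have nb1E : `|coef_b A1| = s1 * `|coef_b L1|.
  by have [s_gt0 _ _ _ _] := seg1; rewrite b1E normrM gtr0_norm.
have nb2E : `|coef_b A2| = s2 * `|coef_b L2|.
  by have [s_gt0 _ _ _ _] := seg2; rewrite b2E normrM gtr0_norm.
move: seg1 seg2.
(* [log_segment] involves [b] only through its square, so absolute values may replace the [b]
   coefficients. *)
rewrite -(real_normK (num_real (coef_b L1))) -(real_normK (num_real (coef_b L2))).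
by rewrite r1E r2E nb1E nb2E => seg1 seg2 r1_ge0 []; exact: log_segment_mono seg1 seg2 r1_ge0.
Qed.

Theorem theorem10p2 (R : realType) (A1 A2 L1 L2 : 'M[R]_2) :
  no_nonpos_eig A1 -> no_nonpos_eig A2 ->
  PD A1 `<=` PD A2 ->
  is_principal_log A1 L1 -> is_principal_log A2 L2 ->
  opnorm2 L1 <= opnorm2 L2 /\ floor2 L2 <= floor2 L1.
Proof.
move=> _ _ sub log1 log2; rewrite !opnorm2E !floor2E.
have dir := log_direction_le log1 log2 sub.
have normE L : center_norm L = Num.sqrt (coef_a L ^+ 2 + `|coef_b L| ^+ 2) :> R.
  by rewrite real_normK ?num_real.
have dot_le L p q : p ^+ 2 + q ^+ 2 = 1 -> p * coef_a L + q * `|coef_b L| <= center_norm L :> R.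
  move=> pq; apply: unit_dot_le => //; first exact: center_norm_ge0.
  by rewrite center_norm_sqr real_normK ?num_real.
split.
  (* For the norm, [(p, q)] points to the center for [L1] and inclusion is tested in the opposite
     direction. *)
  have [p [q [pq]]] := unit_dot_attained (coef_a L1) `|coef_b L1|.
  rewrite -normE => pqE.
  have := dir (- p) (- q); rewrite !sqrrN => /(_ pq).
  by have := dot_le L2 p q pq; lra.
(* For the co-norm, the test direction points to the center for [L2]. *)
have [p [q [pq]]] := unit_dot_attained (coef_a L2) `|coef_b L2|.
rewrite -normE => pqE.
by have := dir p q pq; have := dot_le L1 p q pq; lra.
Qed.
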